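(* Let $r\ge 2$ and let $H$ be an $r$-graph that is not Sidorenko. Then there exist constants $c,\gamma>0$ such that for all positive integers $n$, \[ \mathrm{ex}(n,H)\ \ge\ \gamma\, n^{\,r-\frac{\mathrm{v}(H)-r}{\mathrm{e}(H)-1}+c}. \]
   Context: An $r$-graph is a finite $r$-uniform hypergraph (edges are $r$-element subsets of the vertex set); $\mathrm{v}(H)$ and $\mathrm{e}(H)$ denote its numbers of vertices and edges. An $r$-graphon is a symmetric measurable function $W:[0,1]^r\to[0,1]$. For an $r$-graph $H$, the homomorphism density is $t_H(W)=\int_{[0,1]^{V(H)}}\prod_{\{u_1,\dots,u_r\}\in E(H)}W(x_{u_1},\dots,x_{u_r})\,dx$. Let $K_r$ be the $r$-graph with a single edge, so $t_{K_r}(W)=\int W$. $H$ is Sidorenko if $t_H(W)\ge t_{K_r}(W)^{\mathrm{e}(H)}$ for every $r$-graphon $W$. The extremal number $\mathrm{ex}(n,H)$ is the maximum number of edges in an $n$-vertex $r$-graph containing no copy of $H$.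
   Formalization: The bound is stated for all n ≥ r instead of all positive integers n: for 1 ≤ n < r an n-vertex r-graph has no edges, so ex(n,H) = 0 while the right-hand side is positive, and the claim fails there. *)

(* Defs.v *)
From HB Require Import structures.
From mathcomp Require Import all_boot all_order all_algebra all_fingroup.
From mathcomp Require Import all_classical all_reals all_analysis.

Set Implicit Arguments.
Unset Strict Implicit.
Unset Printing Implicit Defensive.

Import Order.TTheory GRing.Theory Num.Theory.
Import numFieldNormedType.Exports.

Local Open Scope classical_set_scope.
Local Open Scope ring_scope.

Record hypergraph (r : nat) (V : finType) := Hypergraph {
  edges : {set {set V}};
  hypergraph_uniform : [forall e in edges, #|e| == r]
}.

HB.instance Definition _ (r : nat) (V : finType) := [isSub for @edges r V].
#[warning="-redundant-canonical-projection"]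
HB.instance Definition _ (r : nat) (V : finType) :=
  [Finite of hypergraph r V by <:].

(** A copy of [H] in [G] need not be induced. *)
Definition has_copy (r : nat) (V U : finType)
    (H : hypergraph r V) (G : hypergraph r U) : bool :=
  [exists f : {ffun V -> U},
    injectiveb f && [forall e in edges H, f @: e \in edges G]].

(** The maximum of an empty family is [0]; this only happens when [H] has no
    edge and at most [n] vertices. *)
Definition extremal_number (r : nat) (V : finType) (n : nat) (H : hypergraph r V) : nat :=
  (\max_(G : hypergraph r 'I_n | ~~ has_copy H G) #|edges G|)%N.

Lemma single_edge_uniform (r : nat) :
  [forall e in [set [set: 'I_r]%SET]%SET, #|e| == r].
Proof. by apply/forall_inP => e /set1P->; rewrite cardsT card_ord. Qed.

(** The [r]-graph [K_r]. *)
Definition single_edge (r : nat) : hypergraph r 'I_r :=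
  Hypergraph (single_edge_uniform r).

Definition unit_cube (R : realType) (n : nat) : set (n.-tuple R) :=
  [set x | forall i, tnth x i \in `[0, 1]].

Definition pair_cons (R : realType) (n : nat)
    (p : measurableTypeR R * n.-tuple (measurableTypeR R)) :
    n.+1.-tuple (measurableTypeR R) := [tuple of p.1 :: p.2].

Lemma measurable_pair_cons (R : realType) (n : nat) :
  measurable_fun setT (@pair_cons R n).
Proof. by apply: measurable_cons; [exact: measurable_fst|exact: measurable_snd]. Qed.

HB.instance Definition _ (R : realType) (n : nat) :=
  isMeasurableFun.Build _ _ _ _ (@pair_cons R n) (@measurable_pair_cons R n).

(** Lebesgue measure on [[0, 1]^n], as a probability on [R^n]: the [n]-fold
    product of the uniform probability on [[0, 1]], transported along
    [R * R^n ~ R^(n+1)]. *)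
Fixpoint cube_measure (R : realType) (n : nat) :
    probability (n.-tuple (measurableTypeR R)) R :=
  match n with
  | 0 => \d_([tuple])
  | m.+1 => distribution (uniform_prob (@ltr01 R) \x cube_measure R m)%E
              (@pair_cons R m)
  end.

(** Functions on [[0, 1]^r] are functions on [R^r] whose values outside the
    cube are irrelevant. *)
Record graphon (R : realType) (r : nat) := Graphon {
  graphon_fun :> r.-tuple (measurableTypeR R) -> R;
  graphon_measurable : measurable_fun (@unit_cube R r) graphon_fun;
  graphon_sym : forall (s : 'S_r) (x : r.-tuple R), @unit_cube R r x ->
    graphon_fun [tuple tnth x (s i) | i < r] = graphon_fun x;
  graphon_itv : forall x : r.-tuple R, @unit_cube R r x ->
    0 <= graphon_fun x <= 1
}.

(** A point of [[0, 1]^V] is a [#|V|]-tuple, [u : V] having index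
    [enum_rank u]. For [#|e| = r], the coordinates of [x] at the vertices of
    [e], listed in the order of [enum e]; the default value [0] is unused. *)
Definition edge_coords (R : realType) (r : nat) (V : finType)
    (x : #|V|.-tuple R) (e : {set V}) : r.-tuple R :=
  [tuple nth 0 [seq tnth x (enum_rank u) | u <- enum e] i | i < r].

Definition hom_density (R : realType) (r : nat) (V : finType)
    (H : hypergraph r V) (W : graphon R r) : R :=
  \int[cube_measure R #|V|]_(x in @unit_cube R #|V|)
    (\prod_(e in edges H) W (edge_coords r x e)).

Definition Sidorenko (R : realType) (r : nat) (V : finType)
    (H : hypergraph r V) : Prop :=
  forall W : graphon R r,
    hom_density H W >= hom_density (single_edge r) W ^+ #|edges H|.

(* Main.v *)
Require Import Defs.
From HB Require Import structures.
From mathcomp Require Import all_boot all_order all_algebra all_fingroup.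
From mathcomp Require Import all_classical all_reals all_analysis.
From mathcomp Require Import measurable_realfun ring lra zify.

(** Take [W] with [t_H(W) < s < t ^ e(H)], where [t] is the edge density of [W].
    In the random graph on [n] vertices whose [r]-sets are kept with probability
    [p] times the [N]-th tensor power of [W], the expected number of edges is
    [p * 'C(n, r) * t ^ N] and that of copies of [H] is at most
    [p ^ e(H) * n ^ v(H) * s ^ N].  Deleting an edge from each copy, with [N] a
    small multiple of [ln n] and [p] making the second quantity half of the
    first, beats the usual deletion bound by the factor
    [(t ^ e(H) / s) ^ (N / (e(H) - 1))], a positive power of [n].

    The randomness is removed in two steps: points of the cube are chosen by
    averaging, one tensor factor at a time, and the resulting weights are
    rounded to 0 or 1 because the difference of the two counts is affine in
    each weight. *)

Set Implicit Arguments.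
Unset Strict Implicit.
Unset Printing Implicit Defensive.

Import Order.TTheory GRing.Theory Num.Theory.
Import numFieldNormedType.Exports.

Local Open Scope classical_set_scope.
Local Open Scope ring_scope.

(** * Product boxes and the cube measure *)

Section box.
Context d (T : measurableType d) (n : nat).

Definition box (A : 'I_n -> set T) : set (n.-tuple T) :=
  [set x | forall i, A i (tnth x i)].

Lemma measurable_box (A : 'I_n -> set T) :
  (forall i, measurable (A i)) -> measurable (box A).
Proof.
move=> mA.
rewrite (_ : box A = \bigcap_(i in [set: 'I_n]) ((@tnth n T)^~ i @^-1` A i)).
  apply: fin_bigcap_measurable; first exact: finite_finset.
  by move=> i _; rewrite -[X in measurable X]setTI; exact: measurable_tnth.
by apply/seteqP; split=> [x Ax i _|x Ax i]; exact: Ax.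
Qed.

Definition boxes : set (set (n.-tuple T)) :=
  [set B | exists2 A, (forall i, measurable (A i)) & B = box A].

Lemma setI_closed_boxes : setI_closed boxes.
Proof.
move=> _ _ [A mA ->] [B mB ->]; exists (fun i => A i `&` B i).
  by move=> i; exact: measurableI.
apply/seteqP; split=> [x [Ax Bx] i|x ABx]; first by split.
by split=> i; have [] := ABx i.
Qed.

Lemma measurable_boxes : @measurable _ (n.-tuple T) = <<s boxes >>.
Proof.
apply/seteqP; split.
  apply: smallest_sub; first exact: smallest_sigma_algebra.
  elim/big_ind: _ => [//|X Y XB YB|i _].
    by move=> A [/XB//|/YB].
  move=> _ [B mB <-]; apply: sub_sigma_algebra.
  exists (fun j => if j == i then B else setT).
    by move=> j; case: ifP.
  rewrite setTI; apply/seteqP; split=> x /= => [xB j|/(_ i)].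
    by case: eqP => // ->.
  by rewrite eqxx.
apply: smallest_sub; first exact: sigma_algebra_measurable.
by move=> _ [A mA ->]; exact: measurable_box.
Qed.

(** Uniqueness of measures on a generating pi-system: boxes are stable under intersection, generate
    the sigma-algebra and include the whole space, whose mass is finite. *)
Lemma eq_measure_boxes (R : realType)
    (mu nu : {measure set (n.-tuple T) -> \bar R}) :
  (mu setT < +oo)%E ->
  (forall A, (forall i, measurable (A i)) -> mu (box A) = nu (box A)) ->
  forall X, measurable X -> mu X = nu X.
Proof.
move=> muoo munu X mX.
have boxT : setT = box (fun=> setT) by apply/seteqP; split.
apply: (measure_unique boxes (fun=> setT)) => //.
- exact: measurable_boxes.
- exact: setI_closed_boxes.
- by move=> _; exists (fun=> setT).
- by rewrite bigcup_const//; exists 0%N.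
- by move=> _ [A mA ->]; exact: munu.
Qed.

End box.

Lemma cube_measure_box (R : realType) (n : nat)
    (A : 'I_n -> set (measurableTypeR R)) :
  (forall i, measurable (A i)) ->
  cube_measure R n (box A) = (\prod_(i < n) uniform_prob (@ltr01 R) (A i))%E.
Proof.
elim: n A => [|n IH] A mA.
  by rewrite big_ord0 /= diracE mem_set// => -[].
rewrite big_ord_recl -IH => [|i]; last exact: mA.
rewrite -product_measure1E//; last by apply: measurable_box => i; exact: mA.
rewrite /= /pushforward /=; congr (_ _).
apply/seteqP; split=> [[x y] /= Axy|[x y] /= [Ax Ay] i].
  split; first by have := Axy ord0; rewrite tnth0.
  by move=> i; have := Axy (lift ord0 i); rewrite tnthS.
by case: (unliftP ord0 i) => [j ->|->]; rewrite (tnth0, tnthS)//; exact: Ay.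
Qed.

Lemma unit_cube_box (R : realType) (n : nat) :
  @unit_cube R n = box (fun=> [set` `[0, 1]] : set (measurableTypeR R)).
Proof. by []. Qed.

Lemma measurable_unit_cube (R : realType) (n : nat) :
  measurable (@unit_cube R n : set (n.-tuple (measurableTypeR R))).
Proof.
by rewrite unit_cube_box; apply: measurable_box => i; exact: measurable_itv.
Qed.

Lemma cube_measure_unit_cube (R : realType) (n : nat) :
  cube_measure R n (@unit_cube R n) = 1%E.
Proof.
rewrite unit_cube_box cube_measure_box; last by move=> i; exact: measurable_itv.
apply: big1 => i _.
by rewrite /uniform_prob integral_uniform_pdf1.
Qed.

(** * Marginals of the cube measure *)

Section reindex.
Context (R : realType) (n k : nat) (g : 'I_k -> 'I_n).

Definition tuple_sel (x : n.-tuple (measurableTypeR R)) :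
  k.-tuple (measurableTypeR R) := [tuple tnth x (g i) | i < k].

Lemma measurable_tuple_sel : measurable_fun setT tuple_sel.
Proof.
apply/measurable_fun_tnthP => i.
rewrite (_ : _ \o _ = (@tnth n (measurableTypeR R))^~ (g i)).
  exact: measurable_tnth.
by apply/funext => x /=; rewrite tnth_mktuple.
Qed.

HB.instance Definition _ :=
  isMeasurableFun.Build _ _ _ _ tuple_sel measurable_tuple_sel.

Hypothesis g_inj : injective g.

(** It suffices to compare boxes. The preimage of a box is a box whose sides off the image of [g]
    are full, hence of mass 1; injectivity of [g] makes each [A i] occur exactly once among the
    others. *)
Lemma cube_measure_sel (X : set (k.-tuple (measurableTypeR R))) :
  measurable X ->
  distribution (cube_measure R n) tuple_sel X = cube_measure R k X.
Proof.
move=> mX; apply: eq_measure_boxes mX; first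
  by rewrite [ltLHS](@probability_setT _ _ _ (distribution _ tuple_sel)) ltry.
move=> A mA.
change (cube_measure R n (tuple_sel @^-1` box A) = cube_measure R k (box A)).
rewrite [RHS]cube_measure_box//.
pose B j : set (measurableTypeR R) :=
  if [pick i | g i == j] is Some i then A i else setT.
have mB j : measurable (B j) by rewrite /B; case: pickP.
have Bg i : B (g i) = A i.
  by rewrite /B; case: pickP => [i' /eqP/g_inj->//|/(_ i)]; rewrite eqxx.
rewrite (_ : _ @^-1` _ = box B); last first.
  apply/seteqP; split=> [x /= Ax j|x /= Bx i].
    rewrite /B; case: pickP => // i /eqP <-.
    by have := Ax i; rewrite tnth_mktuple.
  by rewrite tnth_mktuple -Bg; exact: Bx.
rewrite cube_measure_box// (bigID (mem (g @: [set: 'I_k]%SET)))/=.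
rewrite [X in (_ * X)%E]big1 => [|j jg].
  rewrite mule1 big_imset => [|? ? _ _]; last exact: g_inj.
  by apply: eq_big => [i|i _]; rewrite ?finset.in_setT ?Bg.
rewrite /B; case: pickP => [i /eqP gij|_]; last exact: probability_setT.
by case/negP: jg; rewrite -gij; apply: imset_f; rewrite finset.in_setT.
Qed.

Lemma Rintegral_cube_sel (h : k.-tuple (measurableTypeR R) -> R) :
  measurable_fun (@unit_cube R k) h ->
  (forall y, @unit_cube R k y -> 0 <= h y) ->
  \int[cube_measure R n]_(x in @unit_cube R n) h (tuple_sel x) =
  \int[cube_measure R k]_(y in @unit_cube R k) h y.
Proof.
move=> mh h0; congr fine.
have mK := @measurable_unit_cube R k.
have mN := @measurable_unit_cube R n.
have sub : @unit_cube R n `<=` tuple_sel @^-1` (@unit_cube R k).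
  by move=> x xN i; rewrite tnth_mktuple; exact: xN.
have /measurable_EFinP meh := mh.
have mpre : measurable (tuple_sel @^-1` (@unit_cube R k)).
  by rewrite -[X in measurable X]setTI; exact: measurable_tuple_sel.
transitivity (\int[distribution (cube_measure R n) tuple_sel]_(y in
    @unit_cube R k) (h y)%:E)%E; last first.
  by apply: eq_measure_integral => A mA _; exact: cube_measure_sel.
rewrite [RHS](ge0_integral_pushforward measurable_tuple_sel
  (cube_measure R n) (D := @unit_cube R k) (f := EFin \o h))//=; last first.
  by move=> y /set_mem yK; rewrite /= lee_fin h0.
have mhsel : measurable_fun (tuple_sel @^-1` (@unit_cube R k))
    (fun x => (h (tuple_sel x))%:E).
  apply: (measurable_comp mK _ meh).
    by move=> _ [x xK <-].
  exact: measurable_funTS measurable_tuple_sel.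
(* The preimage of the small cube leaves unselected coordinates free, so it may exceed the big cube;
   the excess is null. *)
rewrite [RHS](@ge0_negligible_integral _ _ R (cube_measure R n) _
  (~` @unit_cube R n) _ (measurableC mN) mpre mhsel)//.
- by rewrite setDE setCK setIidr.
- by move=> x xK; rewrite lee_fin h0.
- by rewrite [LHS]probability_setC ?cube_measure_unit_cube ?subee.
Qed.

End reindex.

(** * Averaging over a probability space *)

Section averaging.
Context d (T : measurableType d) (R : realType).
Variable P : probability T R.
Variable D : set T.
Hypothesis mD : measurable D.

Lemma Rintegral_sum (I : Type) (s : seq I) (Q : pred I) (F : I -> T -> R) :
  (forall i, P.-integrable D (EFin \o F i)) ->
  P.-integrable D (EFin \o (fun x => \sum_(i <- s | Q i) F i x)) /\
  \int[P]_(x in D) (\sum_(i <- s | Q i) F i x) =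
  \sum_(i <- s | Q i) \int[P]_(x in D) F i x.
Proof.
move=> intF; elim: s => [|i s [ints IH]].
  rewrite big_nil (_ : (fun x => _) = cst 0) => [|]; last first.
    by apply/funext => x; rewrite big_nil.
  by split; [exact: integrable0|rewrite Rintegral_cst// mul0r].
rewrite big_cons (_ : (fun x => _) = fun x =>
  (if Q i then F i x else 0) + \sum_(j <- s | Q j) F j x); last first.
  by apply/funext => x; rewrite big_cons; case: ifP => //; rewrite add0r.
case: ifP => _.
  split; last by rewrite RintegralD// IH.
  exact: (integrableD mD (intF i) ints).
by under eq_fun do rewrite add0r.
Qed.

(** Otherwise [c - f], with [c] the integral, would be strictly positive on [D] with integral 0,
    which would make [D] null. *)
Lemma exists_ge_Rintegral (f : T -> R) :
  P D = 1%E -> P.-integrable D (EFin \o f) ->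
  exists2 x, D x & \int[P]_(x in D) f x <= f x.
Proof.
move=> PD1 intf; apply: contrapT => noX.
set c := \int[P]_(x in D) f x.
have fc x : D x -> f x < c.
  by move=> Dx; rewrite ltNge; apply/negP => cf; apply: noX; exists x.
have intc : P.-integrable D (EFin \o cst c).
  by apply: finite_measure_integrable_cst.
have intg : P.-integrable D (EFin \o (fun x => c - f x)).
  exact: (integrableB mD intc intf).
have g0 : \int[P]_(x in D) (c - f x) = 0.
  by rewrite (RintegralB mD intc intf) Rintegral_cst//= PD1 mulr1 subrr.
have : (\int[P]_(x in D) `|(c - f x)%:E| = 0)%E.
  rewrite -[RHS]/(0%R%:E) -g0 /Rintegral fineK; last first.
    exact: integrable_fin_num intg.
  apply: eq_integral => x /set_mem Dx.
  by rewrite /= ger0_norm// subr_ge0 ltW// fc.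
move/(ae_eq_integral_abs P mD (measurable_int P intg)) => [N [mN N0 DN]].
have : (P D <= P N)%E.
  apply: le_measure; rewrite ?inE// => x Dx; apply: DN => /= /(_ Dx)[].
  by move/eqP; rewrite subr_eq0 gt_eqF// fc.
by rewrite PD1 N0 lee_fin ler10.
Qed.

End averaging.

(** * Weights of vertex sets at a point of the cube *)

Section graphon_weights.
Context (R : realType) (r : nat) (W : graphon R r).

Section coordinates.
Variable U : finType.
Implicit Types (x : #|U|.-tuple (measurableTypeR R)) (S : {set U}).

Lemma edge_coords_sel S (cS : #|S| = r) x :
  edge_coords r x S =
  tuple_sel (fun i => enum_rank (enum_val (cast_ord (esym cS) i))) x.
Proof.
apply: eq_from_tnth => i; rewrite !tnth_mktuple.
have u0 : U by apply: (enum_val (A := S)); apply: cast_ord i.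
rewrite (nth_map u0) -?cardE ?cS//.
by congr (tnth _ (enum_rank _)); rewrite (enum_val_nth u0).
Qed.

Lemma unit_cube_edge_coords S x : #|S| = r -> unit_cube x ->
  unit_cube (edge_coords r x S).
Proof.
by move=> cS xU i; rewrite (edge_coords_sel cS) tnth_mktuple; exact: xU.
Qed.

(** The value 0 on sets of the wrong size makes this a total weighting of [{set U}], so that
    weightings can be multiplied and rounded without size conditions. *)
Definition graphon_weight x S : R :=
  if #|S| == r then W (edge_coords r x S) else 0.

Lemma graphon_weight_itv x S : unit_cube x -> 0 <= graphon_weight x S <= 1.
Proof.
move=> xU; rewrite /graphon_weight; case: eqP => [cS|_]; last first.
  by rewrite lexx ler01.
by apply: graphon_itv; exact: unit_cube_edge_coords.
Qed.

Lemma measurable_graphon_weight S :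
  measurable_fun (@unit_cube R #|U|) (fun x => graphon_weight x S).
Proof.
rewrite /graphon_weight; case: eqP => [cS|_]; last exact: measurable_cst.
apply: (measurable_comp (@measurable_unit_cube R r) _ (graphon_measurable W)).
  by move=> _ [x xU <-]; exact: unit_cube_edge_coords.
under eq_fun do rewrite (edge_coords_sel cS).
exact: measurable_funTS (measurable_tuple_sel _).
Qed.

Lemma integrable_graphon_weight_prod (I : finType) (A : {set I})
    (S : I -> {set U}) :
  (cube_measure R #|U|).-integrable (@unit_cube R #|U|)
    (EFin \o (fun x => \prod_(i in A) graphon_weight x (S i))).
Proof.
apply: measurable_bounded_integrable.
- exact: measurable_unit_cube.
- by rewrite [ltLHS]cube_measure_unit_cube ltry.
- under eq_fun do rewrite -big_enum.
  by apply: measurable_prod => i _; exact: measurable_graphon_weight.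
- exists 1; split; first by rewrite num_real.
  move=> M M1 x xU /=; rewrite (le_trans _ (ltW M1))//.
  rewrite ger0_norm; last first.
    by apply: prodr_ge0 => i _; case/andP: (graphon_weight_itv (S i) xU).
  by apply: prodr_ile1 => i _; exact: graphon_weight_itv.
Qed.

End coordinates.

(** Symmetry of [W] in the form needed for edges: [enum (f @: e)] and the image of [enum e] may list
    the same vertices in different orders. *)
Lemma graphon_perm_eq (s t : seq R) : size s = r -> perm_eq s t ->
  (forall z, z \in s -> z \in `[0, 1]) ->
  W [tuple nth 0 s i | i < r] = W [tuple nth 0 t i | i < r].
Proof.
have tupE (u : seq R) : size u = r -> val [tuple nth 0 u i | i < r] = u.
  move=> su; apply: (@eq_from_nth _ 0); rewrite size_tuple ?su// => i ir.
  by rewrite -(tnth_nth _ _ (Ordinal ir)) tnth_mktuple.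
move=> ss st s01; have sizet : size t = r by rewrite -(perm_size st).
have := st; rewrite -{1}(tupE t sizet) => /tuple_permP[p sE].
rewrite -[RHS](graphon_sym W p); last first.
  move=> i; rewrite tnth_mktuple; apply: s01.
  by rewrite (perm_mem st) mem_nth// sizet.
by congr (W _); apply: val_inj; rewrite [LHS]tupE.
Qed.

Lemma graphon_weight_imset (V U : finType) (f : V -> U) (f_inj : injective f)
    (e : {set V}) (x : #|U|.-tuple R) : unit_cube x ->
  graphon_weight x (f @: e) =
  graphon_weight (tuple_sel (fun i => enum_rank (f (enum_val i))) x) e.
Proof.
move=> xU; rewrite /graphon_weight card_imset//; case: eqP => // ce.
have eqs : [seq tnth (tuple_sel (fun i => enum_rank (f (enum_val i))) x)
      (enum_rank u) | u <- enum e] =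
    [seq tnth x (enum_rank u) | u <- map f (enum e)].
  by rewrite -map_comp; apply: eq_map => u /=; rewrite tnth_mktuple enum_rankK.
rewrite /edge_coords eqs; apply: graphon_perm_eq.
- by rewrite size_map -cardE card_imset.
- apply/perm_map/uniq_perm; rewrite ?enum_uniq ?map_inj_uniq ?enum_uniq//.
  move=> u; rewrite mem_enum; apply/imsetP/mapP => -[v];
    rewrite ?mem_enum => ve ->; exists v => //.
  by rewrite mem_enum.
- by move=> _ /mapP[u _ ->]; exact: xU.
Qed.

(** The coordinates of a random point at the distinct vertices [f v] are independent and uniform, so
    every embedded copy of [H] has the same expected weight. *)
Lemma Rintegral_graphon_weight (V U : finType) (H : hypergraph r V)
    (f : V -> U) (f_inj : injective f) :
  \int[cube_measure R #|U|]_(x in @unit_cube R #|U|)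
    (\prod_(e in edges H) graphon_weight x (f @: e)) = hom_density H W.
Proof.
pose h (y : #|V|.-tuple (measurableTypeR R)) :=
  \prod_(e in edges H) graphon_weight y e.
have -> : hom_density H W =
    \int[cube_measure R #|V|]_(y in @unit_cube R #|V|) h y.
  apply: eq_Rintegral => y _; apply: eq_bigr => e eH.
  by rewrite /graphon_weight (forall_inP (hypergraph_uniform H) e eH).
rewrite -(@Rintegral_cube_sel R #|U| #|V|
  (fun i => enum_rank (f (enum_val i)))).
- apply: eq_Rintegral => x /set_mem xU; apply: eq_bigr => e _.
  exact: graphon_weight_imset.
- by move=> i j /enum_rank_inj/f_inj/enum_val_inj.
- have /integrableP[/measurable_EFinP mh _] :=
    integrable_graphon_weight_prod (edges H) id.
  exact: mh.
- by move=> y yU; apply: prodr_ge0 => e _; case/andP: (graphon_weight_itv e yU).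
Qed.

End graphon_weights.

(** * Rounding of multiaffine functions *)

Section multiaffine.
Context (R : realDomainType) (T : finType).
Implicit Types (w : T -> R) (F : (T -> R) -> R).

Definition multiaffine F := forall w i,
  F w = w i * F [eta w with i |-> 1] + (1 - w i) * F [eta w with i |-> 0].

(** Each variable occurs at most once in the product. *)
Lemma multiaffine_prod (A : {set T}) :
  multiaffine (fun w => \prod_(i in A) w i).
Proof.
move=> w i; have [iA|iA] := boolP (i \in A).
  rewrite !(big_setD1 i iA)/= eqxx mul1r mul0r mulr0 addr0; congr (_ * _).
  by apply: eq_bigr => j; rewrite !inE => /andP[/negbTE ->].
have E c : \prod_(j in A) [eta w with i |-> c] j = \prod_(j in A) w j.
  apply: eq_bigr => j jA /=; case: eqP => // ji.
  by rewrite -ji jA in iA.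
by rewrite !E -mulrDl addrC subrK mul1r.
Qed.

Lemma multiaffineZ a F : multiaffine F -> multiaffine (fun w => a * F w).
Proof. by move=> Fa w i; rewrite {1}(Fa w i); ring. Qed.

Lemma multiaffineB F G :
  multiaffine F -> multiaffine G -> multiaffine (fun w => F w - G w).
Proof. by move=> Fa Ga w i; rewrite {1}(Fa w i) {1}(Ga w i); ring. Qed.

Lemma multiaffine_sum (I : finType) (Q : pred I) (F : I -> (T -> R) -> R) :
  (forall j, Q j -> multiaffine (F j)) ->
  multiaffine (fun w => \sum_(j | Q j) F j w).
Proof.
move=> Fa w i; rewrite !mulr_sumr -big_split/=.
by apply: eq_bigr => j Qj; exact: Fa.
Qed.

(** Along one coordinate [F] is a convex combination of its two endpoint values, so moving to the
    larger one does not decrease it; this is done coordinate by coordinate. *)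
Lemma multiaffine_le_vertex F w : multiaffine F ->
  (forall i, 0 <= w i <= 1) ->
  exists A : {set T}, F w <= F (fun i => (i \in A)%:R).
Proof.
move=> Fa w01.
suff [w' [Fw w'01]] : exists w' : T -> R,
    F w <= F w' /\ forall i, i \in enum T -> w' i = 0 \/ w' i = 1.
  exists [set i | w' i == 1]%SET; rewrite (le_trans Fw)// le_eqVlt.
  apply/orP; left; apply/eqP; congr F; apply/funext => i; rewrite finset.inE.
  by have [->|->] := w'01 i (mem_enum _ _); rewrite ?eqxx// eq_sym oner_eq0.
suff [w' [_ [Fw w'01]]] : exists w' : T -> R, (forall i, 0 <= w' i <= 1) /\
    (F w <= F w' /\ forall i, i \in enum T -> w' i = 0 \/ w' i = 1) by exists w'.
elim: (enum T) => [|i s [w' [w'01 [Fw w's]]]]; first by exists w.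
have step c : 0 <= c <= 1 -> (c = 0 \/ c = 1) ->
    F w' <= F [eta w' with i |-> c] ->
    exists w'' : T -> R, (forall i, 0 <= w'' i <= 1) /\
    (F w <= F w'' /\ forall j, j \in i :: s -> w'' j = 0 \/ w'' j = 1).
  move=> c01 c0V1 Fc; exists [eta w' with i |-> c]; split.
    by move=> j /=; case: eqP.
  split; first exact: le_trans Fc.
  by move=> j; rewrite inE /=; case: eqP => //= _ /w's.
have [F10|F01] := leP (F [eta w' with i |-> 1]) (F [eta w' with i |-> 0]).
  apply: (step 0); rewrite ?lexx ?ler01//; first by left.
  have /andP[wi0 wi1] := w'01 i; rewrite [leLHS](Fa w' i).
  by have := ler_wpM2l wi0 F10; lra.
apply: (step 1); rewrite ?lexx ?ler01//; first by right.
have /andP[wi0 wi1] := w'01 i; rewrite [leLHS](Fa w' i).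
have wi1' : 0 <= 1 - w' i by rewrite subr_ge0.
by have := ler_wpM2l wi1' (ltW F01); lra.
Qed.

End multiaffine.

Lemma hom_density_ge0 (R : realType) (r : nat) (V : finType)
    (H : hypergraph r V) (W : graphon R r) : 0 <= hom_density H W.
Proof.
apply: Rintegral_ge0 => x xU; apply: prodr_ge0 => e eH.
have := graphon_weight_itv W e xU; rewrite /graphon_weight.
by rewrite (forall_inP (hypergraph_uniform H) e eH) => /andP[].
Qed.

(** * The deletion method with weights *)

Section embeddings.
Context (r : nat) (V : finType) (H : hypergraph r V).

Lemma extremal_number_deletion (n : nat) (A : {set {set 'I_n}}) :
  edges H != finset.set0 ->
  (#|[set S in A | #|S| == r]%SET| <= extremal_number n H +
    #|[set f : {ffun V -> 'I_n} | injectiveb f &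
        [forall e in edges H, f @: e \in A]]%SET|)%N.
Proof.
case/set0Pn => e0 e0H.
set Ar := [set S in A | _]%SET; set C := [set f | _ & _]%SET.
(* Deleting one edge of each copy of [H] leaves an [H]-free graph. *)
pose D := (Ar :\: [set (f : {ffun V -> 'I_n}) @: e0 | f in C]%SET)%SET.
have Du : [forall e in D, #|e| == r].
  by apply/forall_inP => S; rewrite !finset.inE => /andP[_ /andP[_]].
have Dfree : ~~ has_copy H (Hypergraph Du).
  apply/existsP => -[f /andP[f_inj /forall_inP fD]].
  have fA e : e \in edges H -> f @: e \in A.
    by move=> /fD; rewrite !finset.inE => /andP[_ /andP[]].
  have := fD _ e0H; rewrite finset.inE => /andP[/negP[]].
  by apply/imsetP; exists f => //; rewrite finset.inE f_inj; apply/forall_inP.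
have : (#|D| <= extremal_number n H)%N.
  exact: (leq_bigmax_cond (Hypergraph Du) Dfree).
rewrite -(leq_add2r #|C|); apply: leq_trans.
rewrite -(cardsID [set (f : {ffun V -> 'I_n}) @: e0 | f in C]%SET Ar).
rewrite addnC leq_add2l.
by rewrite (leq_trans (subset_leq_card (finset.subsetIr _ _)))// leq_imset_card.
Qed.

Variable R : realType.

(** With [a = b = 1] and [w] in [0, 1], this is the expected number of edges minus that of
    embeddings of [H] when sets are kept independently with probabilities [w]. The coefficients [a]
    and [b] absorb tensor factors that are already fixed. *)
Definition deletion_gain (U : finType) (a : {set U} -> R)
    (b : {ffun V -> U} -> R) (w : {set U} -> R) : R :=
  \sum_(S : {set U} | #|S| == r) a S * w S -
  \sum_(f : {ffun V -> U} | injectiveb f) b f * \prod_(e in edges H) w (f @: e).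

(** An injective [f] sends distinct edges to distinct sets, so no weight is repeated in a
    product. *)
Lemma multiaffine_deletion_gain (U : finType) (a : {set U} -> R)
    (b : {ffun V -> U} -> R) : multiaffine (deletion_gain a b).
Proof.
apply: multiaffineB.
  apply: multiaffine_sum => S _; apply: multiaffineZ.
  have := multiaffine_prod (R := R) [set S]%SET.
  by under eq_fun do rewrite big_set1.
apply: multiaffine_sum => f /injectiveP f_inj; apply: multiaffineZ.
have := multiaffine_prod (R := R) [set f @: (e : {set V}) | e in edges H]%SET.
by under eq_fun do rewrite (big_imset _ (in2W (imset_inj f_inj))).
Qed.

Lemma deletion_gain_le_extremal (n : nat) (w : {set 'I_n} -> R) :
  edges H != finset.set0 -> (forall S, 0 <= w S <= 1) ->
  deletion_gain (fun=> 1) (fun=> 1) w <= (extremal_number n H)%:R.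
Proof.
move=> H0 w01; have [A] := multiaffine_le_vertex
  (multiaffine_deletion_gain (fun=> 1) (fun=> 1)) w01.
move/le_trans; apply; rewrite /deletion_gain.
have -> : \sum_(S : {set 'I_n} | #|S| == r) 1 * (S \in A)%:R =
    #|[set S in A | #|S| == r]%SET|%:R :> R.
  rewrite -sum1_card natr_sum big_mkcond/= [RHS]big_mkcond/=.
  by apply: eq_bigr => S _; rewrite finset.inE mul1r; case: (S \in A); case: eqP.
have -> : \sum_(f : {ffun V -> 'I_n} | injectiveb f)
      1 * \prod_(e in edges H) (f @: e \in A)%:R =
    #|[set f : {ffun V -> 'I_n} | injectiveb f &
        [forall e in edges H, f @: e \in A]]%SET|%:R :> R.
  rewrite -sum1_card natr_sum big_mkcond/= [RHS]big_mkcond/=.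
  apply: eq_bigr => f _; rewrite finset.inE mul1r; case: ifP => //= _.
  have [/forall_inP fA|] := boolP [forall e in edges H, f @: e \in A].
    by apply: big1 => e /fA ->.
  by move=> /forall_inPn[e eH /negbTE fe]; rewrite (bigD1 e)//= fe mul0r.
by rewrite lerBlDr -natrD ler_nat extremal_number_deletion.
Qed.

(** The left side is the mean of the gain of [graphon_weight W x] over random [x], and some [x] does
    at least as well as the mean. *)
Lemma graphon_deletion_gain (W : graphon R r) (U : finType)
    (a : {set U} -> R) (b : {ffun V -> U} -> R) :
  exists w : {set U} -> R, (forall S, 0 <= w S <= 1) /\
    hom_density (single_edge r) W * (\sum_(S : {set U} | #|S| == r) a S) -
    hom_density H W * (\sum_(f : {ffun V -> U} | injectiveb f) b f)
    <= deletion_gain a b w.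
Proof.
have mU := @measurable_unit_cube R #|U|.
have intZ c (h : #|U|.-tuple (measurableTypeR R) -> R) :
    (cube_measure R #|U|).-integrable (@unit_cube R #|U|) (EFin \o h) ->
    (cube_measure R #|U|).-integrable (@unit_cube R #|U|)
      (EFin \o (fun x => c * h x)).
  by move=> hint; exact: (integrableZl mU c hint).
have intS (S : {set U}) : (cube_measure R #|U|).-integrable (@unit_cube R #|U|)
    (EFin \o (fun x => graphon_weight W x S)).
  have := integrable_graphon_weight_prod W [set S]%SET id.
  by under eq_fun do rewrite big_set1.
have intf (f : {ffun V -> U}) :
    (cube_measure R #|U|).-integrable (@unit_cube R #|U|)
    (EFin \o (fun x => \prod_(e in edges H) graphon_weight W x (f @: e))).
  exact: (integrable_graphon_weight_prod W (edges H) (fun e => f @: e)).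
have [intA EA] := Rintegral_sum mU (index_enum _) (fun S : {set U} => #|S| == r)
  (fun S => intZ (a S) _ (intS S)).
have [intB EB] := Rintegral_sum mU (index_enum _)
  (fun f : {ffun V -> U} => injectiveb f) (fun f => intZ (b f) _ (intf f)).
have [x xU] := exists_ge_Rintegral mU (cube_measure_unit_cube R #|U|)
  (integrableB mU intA intB).
rewrite (RintegralB mU intA intB) EA EB => le_x.
exists (graphon_weight W x); split; first by move=> S; exact: graphon_weight_itv.
rewrite (le_trans _ le_x)// le_eqVlt; apply/orP; left; apply/eqP.
congr (_ - _); rewrite mulr_sumr; apply: eq_bigr.
  move=> S /eqP cS; rewrite RintegralZl// mulrC; congr (_ * _).
  (* Enumerating [S] embeds [single_edge r] with its edge mapped onto [S]. *)
  have inj : injective (fun i => enum_val (cast_ord (esym cS) i)).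
    by move=> i j /enum_val_inj/cast_ord_inj.
  rewrite -(Rintegral_graphon_weight W (single_edge r) inj).
  apply: eq_Rintegral => y _; rewrite big_set1; congr graphon_weight.
  apply/eqP; rewrite eqEcard card_imset// cardsT card_ord [in leqLHS]cS.
  rewrite leqnn andbT.
  by apply/fintype.subsetP => _ /imsetP[i _ ->]; exact: enum_valP.
move=> f /injectiveP f_inj; rewrite RintegralZl// mulrC; congr (_ * _).
by rewrite (Rintegral_graphon_weight W H f_inj).
Qed.

(** The pointwise product of [N] weightings plays the role of the [N]-th tensor
    power of [W]; its weights are produced one factor at a time. *)
Lemma graphon_power_deletion_gain (W : graphon R r) (U : finType)
    (a : {set U} -> R) (b : {ffun V -> U} -> R) (N : nat) :
  exists w : {set U} -> R, (forall S, 0 <= w S <= 1) /\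
    hom_density (single_edge r) W ^+ N * (\sum_(S : {set U} | #|S| == r) a S) -
    hom_density H W ^+ N * (\sum_(f : {ffun V -> U} | injectiveb f) b f)
    <= deletion_gain a b w.
Proof.
set t := hom_density (single_edge r) W; set s := hom_density H W.
elim: N a b => [|N IH] a b.
  exists (fun=> 1); split; first by move=> _; rewrite ler01 lexx.
  rewrite !expr0 !mul1r le_eqVlt; apply/orP; left; apply/eqP.
  by congr (_ - _); apply: eq_bigr => S _; rewrite ?big1_eq mulr1.
(* The first factor is fixed while the other [N] enter through their means; the induction hypothesis
   then takes coefficients multiplied by the weights [w]. *)
have [w [w01 lew]] := graphon_deletion_gain W (fun S => t ^+ N * a S)
  (fun f => s ^+ N * b f).
have [w' [w'01 lew']] := IH (fun S => a S * w S)
  (fun f => b f * \prod_(e in edges H) w (f @: e)).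
exists (fun S => w S * w' S); split.
  move=> S; have /andP[w0 w1] := w01 S; have /andP[w'0 w'1] := w'01 S.
  by rewrite mulr_ge0//= mulr_ile1.
rewrite [leRHS](_ : _ = deletion_gain (fun S => a S * w S)
  (fun f => b f * \prod_(e in edges H) w (f @: e)) w'); last first.
  congr (_ - _); apply: eq_bigr => S _; first by rewrite mulrA.
  by rewrite big_split/= mulrA.
apply: le_trans lew'; rewrite !exprS -!mulrA.
rewrite [X in t * X]mulr_sumr [X in s * X]mulr_sumr.
apply: le_trans lew _; rewrite /deletion_gain !mulr_sumr.
rewrite le_eqVlt; apply/orP; left; apply/eqP.
by congr (_ - _); apply: eq_bigr => S _; rewrite mulrA.
Qed.

(** Thinning all weights by [p] multiplies the edge coefficients by [p] and the copy coefficients by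
    [p ^+ #|edges H|]; injections are bounded in number by all maps. *)
Lemma extremal_number_ge (W : graphon R r) (n N : nat) (p : R) :
  edges H != finset.set0 -> 0 <= p <= 1 ->
  p * 'C(n, r)%:R * hom_density (single_edge r) W ^+ N -
  p ^+ #|edges H| * n%:R ^+ #|V| * hom_density H W ^+ N
  <= (extremal_number n H)%:R.
Proof.
move=> H0 /andP[p0 p1].
have [w [w01 lew]] := graphon_power_deletion_gain W (U := 'I_n)
  (fun=> p) (fun=> p ^+ #|edges H|) N.
apply: le_trans (deletion_gain_le_extremal (w := fun S => p * w S) H0 _);
  last first.
  move=> S; have /andP[w0 w1] := w01 S.
  by rewrite mulr_ge0//= mulr_ile1.
rewrite [leRHS](_ : _ = deletion_gain (fun=> p) (fun=> p ^+ #|edges H|) w);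
  last first.
  congr (_ - _); apply: eq_bigr => S _; first by rewrite mul1r.
  by rewrite big_split/= prodr_const mul1r.
apply: le_trans lew; rewrite !sumr_const.
have -> : #|[pred S : {set 'I_n} | #|S| == r]| = 'C(n, r).
  by rewrite -[in RHS](card_ord n) -card_draws cardsE.
apply: lerB; first by rewrite mulrC mulr_natr.
rewrite [leLHS]mulrC ler_wpM2r ?exprn_ge0 ?hom_density_ge0//.
rewrite -natrX mulr_natr ler_wpMn2l ?exprn_ge0//.
by rewrite -[in leqRHS](card_ord n) -card_ffun max_card.
Qed.
End embeddings.

(** * A binomial estimate and the choice of parameters *)

Lemma leq_expn_bin (n r : nat) : (r <= n)%N ->
  (n ^ r <= r ^ r * r`! * 'C(n, r))%N.
Proof.
move=> rn; rewrite -mulnA [(r`! * _)%N]mulnC bin_ffact ffact_prod.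
have prodE m : (m ^ r = \prod_(i < r) m)%N by rewrite prod_nat_const card_ord.
(* Factor by factor, [n <= r * (n - i)] for [i < r <= n]. *)
rewrite !prodE -big_split/=; apply: leq_prod => i _.
have := ltn_ord i; rewrite -(subnK rn); move: (n - r)%N => k ir.
have -> : (k + r - i = k + (r - i))%N by lia.
have : (0 < r - i)%N by lia.
move: (r - i)%N => j; nia.
Qed.

Section exponent.
Context (R : realType).

Lemma deletion_exponent (r v e : nat) (t s : R) (ex : nat -> nat) :
  (0 < r < v)%N -> (1 < e)%N -> 0 < t -> 0 < s -> s < t ^+ e ->
  (forall n N p, 0 <= p <= 1 ->
    p * 'C(n, r)%:R * t ^+ N - p ^+ e * n%:R ^+ v * s ^+ N <= (ex n)%:R) ->
  exists c gamma : R, 0 < c /\ 0 < gamma /\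
    forall n : nat, (r <= n)%N ->
      gamma * n%:R `^ (r%:R - (v%:R - r%:R) / (e%:R - 1) + c) <= (ex n)%:R.
Proof.
move=> /andP[r0 rv] e1 t0 s0 ste exP.
have powRX x N z : 0 <= x -> (x ^+ N) `^ z = (x `^ z) ^+ N :> R.
  by move=> x0; rewrite -!powR_mulrn ?powR_ge0// -!powRrM mulrC.
pose k : R := (r ^ r * r`!)%:R^-1.
have rr0 : (0 < r ^ r * r`!)%N by rewrite muln_gt0 expn_gt0 r0 fact_gt0.
have k0 : 0 < k by rewrite invr_gt0 ltr0n.
have k1 : k <= 1 by rewrite invf_le1 ?ler1n ?ltr0n.
(* Each tensor factor multiplies [p ^+ e.-1] by [q]; [rho > 1] is the gap given by the failure of
   the Sidorenko inequality. *)
pose q := t / s; pose rho := t ^+ e / s.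
have q0 : 0 < q by rewrite divr_gt0.
have rho1 : 1 < rho by rewrite ltr_pdivlMr// mul1r.
have rho0 : 0 < rho by exact: lt_trans rho1.
(* Any [Q >= q] with [Q > 1] would do; a natural number allows [trunc_log]. *)
pose Q := (Num.bound q).+2.
have qQ : q <= Q%:R.
  rewrite (le_trans (ltW (archi_boundP (ltW q0))))// ler_nat.
  by rewrite ltnW.
have lnQ0 : 0 < ln Q%:R :> R by rewrite ln_gt0// ltr1n.
have lnrho0 : 0 < ln rho by rewrite ln_gt0.
pose a : R := (e%:R - 1)^-1.
have e1R : e.-1%:R = e%:R - 1 :> R by rewrite -subn1 natrB// ltnW.
have e10 : 0 < e%:R - 1 :> R by rewrite -e1R ltr0n -subn1 subn_gt0.
have a0 : 0 < a by rewrite invr_gt0.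
(* This solves [Q]^ c = rho [^ a], so that [n < Q ^ N.+1] gives [n]^ c <= (rho [^ a) ^+ N.+1]. *)
pose c := a * ln rho / ln Q%:R.
have Qc : Q%:R `^ c = rho `^ a.
  by rewrite /powR gt_eqF ?ltr0n// gt_eqF// /c divfK// gt_eqF.
(* The factor [k / 2] is the surviving half of the edge term, [(k / 2)]^ a[comes from]p[, and]rho
   [^ a] pays for rounding the logarithm down to [N]. *)
exists c, (k / 2 * (k / 2) `^ a / rho `^ a); split.
  by rewrite divr_gt0// mulr_gt0.
have k20 : 0 < k / 2 by rewrite divr_gt0.
split; first by rewrite divr_gt0 ?mulr_gt0 ?powR_gt0.
move=> n rn; have n0 : (0 < n)%N by exact: leq_trans rn.
set y : R := n%:R; have y0 : 0 < y by rewrite ltr0n.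
have /andP[QN nQ] := trunc_log_bounds (isT : (1 < Q)%N) n0.
set N := trunc_log Q n in QN nQ.
(* [X] is chosen so that [p ^+ e * y ^+ v * s ^+ N] is half of the lower bound
   [p * k * y ^+ r * t ^+ N] for the edge term. *)
pose X := k / 2 * q ^+ N / y ^+ (v - r).
have X0 : 0 < X by rewrite divr_gt0 ?mulr_gt0 ?exprn_gt0.
(* Here [q ^+ N <= Q ^ N <= n <= n ^ (v - r)], the last step because [r < v]. *)
have X1 : X <= 1.
  rewrite ler_pdivrMr ?exprn_gt0// mul1r.
  have qNy : q ^+ N <= y.
    rewrite (@le_trans _ _ (Q%:R ^+ N))//.
      by apply: lerXn2r; rewrite ?nnegrE ?ler0n ?(ltW q0).
    by rewrite -natrX ler_nat.
  apply: le_trans (_ : y <= _).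
    by rewrite -[leRHS]mul1r ler_pM// ?exprn_ge0 ?ltW//; lra.
  by rewrite ler_eXnr// ?subn_gt0// ler1n.
pose p := X `^ a.
have p01 : 0 <= p <= 1.
  rewrite powR_ge0/=; have := @ge0_ler_powR R a (ltW a0) X 1.
  by rewrite !nnegrE powR1 ltW//; apply.
have pX : p ^+ e.-1 = X.
  by rewrite -powR_mulrn ?powR_ge0// -powRrM e1R mulVf ?gt_eqF// powRr1// ltW.
apply: le_trans (exP n N p p01).
have kn : k * y ^+ r <= 'C(n, r)%:R.
  by rewrite mulrC ler_pdivrMr ?ltr0n// mulrC -natrX -natrM ler_nat
    leq_expn_bin.
have pe : p ^+ e * y ^+ v * s ^+ N = p * (k / 2 * y ^+ r * t ^+ N).
  rewrite -[e in LHS](prednK (ltnW e1)) exprS pX -!mulrA; congr (p * _).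
  have -> : y ^+ v = y ^+ (v - r) * y ^+ r by rewrite -exprD subnK// ltnW.
  rewrite /X /q expr_div_n.
  by field; rewrite !expf_neq0 ?gt_eqF.
have lb : k / 2 * p * y ^+ r * t ^+ N <=
    p * 'C(n, r)%:R * t ^+ N - p ^+ e * y ^+ v * s ^+ N.
  rewrite pe -subr_ge0.
  have -> : p * 'C(n, r)%:R * t ^+ N - p * (k / 2 * y ^+ r * t ^+ N) -
      k / 2 * p * y ^+ r * t ^+ N =
      (p * t ^+ N) * ('C(n, r)%:R - k * y ^+ r) by field.
  by rewrite mulr_ge0 ?subr_ge0// mulr_ge0 ?powR_ge0 ?exprn_ge0 ?ltW.
apply: le_trans lb.
have pE : p = (k / 2) `^ a * (q `^ a) ^+ N * y `^ (- ((v%:R - r%:R) * a)).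
  rewrite /p /X powRM ?mulr_ge0 ?exprn_ge0 ?invr_ge0 ?ltW//.
    rewrite powRM ?exprn_ge0 ?ltW// powRX ?ltW// -powR_invn ?ltW//.
    by rewrite -powRrM mulNr natrB// ltnW.
    by rewrite ltr0n.
  by rewrite exprn_gt0.
(* Per tensor factor, [p] gains [q]^ a[and the edge density contributes]t[; together they give]rho
   [^ a]. *)
have rhoE : rho `^ a = q `^ a * t.
  have -> : rho = q * t ^+ e.-1.
    by rewrite /rho /q -[in LHS](prednK (ltnW e1)) exprS mulrAC.
  rewrite powRM ?exprn_ge0 ?ltW// -powR_mulrn ?ltW// -powRrM e1R.
  rewrite mulfV ?gt_eqF//.
  by rewrite powRr1 ?(ltW t0)// mulrC.
have nc : y `^ c <= (rho `^ a) ^+ N.+1.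
  rewrite -Qc -powRX// ge0_ler_powR ?nnegrE ?exprn_ge0 ?ltW//.
    by rewrite divr_gt0// mulr_gt0.
  by rewrite -natrX ltr_nat.
have yn0 : y != 0 by rewrite gt_eqF.
rewrite pE powRD ?yn0 ?implybT// powRD ?yn0 ?implybT//.
rewrite powR_mulrn ?(ltW y0)//.
rewrite -/a; set Z := y `^ (- ((v%:R - r%:R) * a)).
have -> : k / 2 * (k / 2) `^ a / rho `^ a * (y ^+ r * Z * y `^ c) =
    (k / 2 * (k / 2) `^ a * y ^+ r * Z) * (y `^ c / rho `^ a).
  by field; rewrite gt_eqF// powR_gt0.
have -> : k / 2 * ((k / 2) `^ a * (q `^ a) ^+ N * Z) * y ^+ r * t ^+ N =
    (k / 2 * (k / 2) `^ a * y ^+ r * Z) * (rho `^ a) ^+ N.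
  by rewrite rhoE exprMn; ring.
apply: ler_wpM2l; last by rewrite ler_pdivrMr ?powR_gt0// -exprSr.
apply: mulr_ge0; last exact: powR_ge0.
by rewrite mulr_ge0 ?exprn_ge0 ?(ltW y0)// mulr_ge0 ?powR_ge0 ?(ltW k20).
Qed.

End exponent.

(** * Hypergraphs with few edges, and the conclusion *)

Section few_edges.
Context (R : realType) (r : nat) (V : finType) (H : hypergraph r V).

Lemma hom_density_edges0 (W : graphon R r) :
  edges H = finset.set0 -> hom_density H W = 1.
Proof.
move=> H0; rewrite -[RHS](mul1r 1) -[X in _ = _ * X]/(fine 1%E).
rewrite -(cube_measure_unit_cube R #|V|) -Rintegral_cst; last first.
  exact: measurable_unit_cube.
by apply: eq_Rintegral => x _; rewrite H0 big_set0.
Qed.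

(** Both densities are integrals over the cube of [V], where [single_edge r] embeds onto [e];
    isolated vertices integrate out. *)
Lemma hom_density_edges1 (W : graphon R r) (e : {set V}) :
  edges H = [set e]%SET -> hom_density H W = hom_density (single_edge r) W.
Proof.
move=> He; have ce : #|e| = r.
  by apply/eqP/(forall_inP (hypergraph_uniform H)); rewrite He finset.set11.
have inj : injective (fun i => enum_val (cast_ord (esym ce) i)).
  by move=> i j /enum_val_inj/cast_ord_inj.
rewrite -(Rintegral_graphon_weight W (single_edge r) inj).
rewrite -(Rintegral_graphon_weight W H (@inj_id V)).
apply: eq_Rintegral => y _; rewrite He !big_set1; congr graphon_weight.
rewrite imset_id; apply/eqP.
rewrite eq_sym eqEcard card_imset// cardsT card_ord [in leqLHS]ce leqnn andbT.
by apply/fintype.subsetP => _ /imsetP[i _ ->]; exact: enum_valP.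
Qed.

Lemma card_edges_non_Sidorenko : ~ Sidorenko R H -> (1 < #|edges H|)%N.
Proof.
move=> nS; rewrite ltnNge; apply/negP => e1; apply: nS => W.
have [/eqP|] := posnP #|edges H|.
  by rewrite cards_eq0 => /eqP H0; rewrite hom_density_edges0// H0 cards0 expr0.
move=> e0; have /eqP/cards1P[e He] : #|edges H| = 1%N by apply/anti_leq/andP.
by rewrite (hom_density_edges1 W He) He cards1 expr1.
Qed.

(** If [#|V| <= r], every edge is the whole of [V], which leaves room for only one. *)
Lemma uniformity_lt_card : (1 < #|edges H|)%N -> (r < #|V|)%N.
Proof.
case/card_gt1P => e1 [e2 [e1H e2H]]; apply: contraNltn => Vr.
have full e : e \in edges H -> e = [set: V]%SET.
  move=> /(forall_inP (hypergraph_uniform H))/eqP ce.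
  by apply/eqP; rewrite eqEcard finset.subsetT cardsT ce.
by rewrite (full e1)// (full e2).
Qed.

End few_edges.

Theorem theorem1p1 (R : realType) (r : nat) (V : finType) (H : hypergraph r V) :
  (2 <= r)%N ->
  ~ Sidorenko R H ->
  exists c gamma : R, 0 < c /\ 0 < gamma /\
    forall n : nat, (r <= n)%N ->
      gamma * n%:R `^ (r%:R - (#|V|%:R - r%:R) / (#|edges H|%:R - 1) + c)
        <= (extremal_number n H)%:R.
Proof.
move=> r2 nS; have e1 := card_edges_non_Sidorenko nS.
have /existsNP[W /negP] := nS; rewrite -ltNge.
set t := hom_density (single_edge r) W => Ht.
have e0 : (0 < #|edges H|)%N by exact: ltnW.
(* If [t = 0], then [t ^+ #|edges H| = 0], and no density lies below 0. *)
have t0 : 0 < t.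
  rewrite lt_neqAle hom_density_ge0 andbT; apply/eqP => t0.
  by move: Ht; rewrite -t0 expr0n eqn0Ngt e0 ltNge hom_density_ge0.
(* [t_H(W)] may vanish, but only an upper bound on it is needed. *)
have [s [s0 [sH st]]] : exists s : R,
    0 < s /\ hom_density H W <= s /\ s < t ^+ #|edges H|.
  exists ((hom_density H W + t ^+ #|edges H|) / 2).
  have := hom_density_ge0 H W; have := exprn_gt0 #|edges H| t0; move: Ht.
  by move: (hom_density H W) (t ^+ _) => x y; clear; lra.
apply: (deletion_exponent _ e1 t0 s0 st) => [|n N p p01].
  by rewrite (ltnW r2) (uniformity_lt_card e1).
have H0 : edges H != finset.set0 by rewrite -card_gt0.
apply: le_trans (extremal_number_ge W n N H0 p01).
have [p0 _] := andP p01.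
rewrite lerB// ler_wpM2l ?mulr_ge0 ?exprn_ge0//.
by rewrite lerXn2r// nnegrE ?hom_density_ge0// ltW.
Qed.
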